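(* If $D$ is a Prüfer domain, then the semiring $\operatorname{FId}(D)$ of finitely generated ideals of $D$ is a Gaussian and Prüfer semiring.
   Context: A Prüfer domain is a commutative integral domain in which every nonzero finitely generated ideal is invertible. A semiring is a set $S$ with operations $+,\cdot$ such that $(S,+)$ is a commutative monoid with identity $0$, $(S,\cdot)$ is a commutative monoid with identity $1\neq 0$, multiplication distributes over addition, and $s\cdot 0=0$ for all $s\in S$. An ideal of $S$ is a nonempty subset $I\subseteq S$ such that $a,b\in I$ and $s\in S$ imply $a+b, sa\in I$. $\operatorname{FId}(D)$ is the set of finitely generated ideals of $D$ with the usual sum and product of ideals; its zero is the zero ideal and its identity is $D$. For $f\in S[X]$, the content $c(f)$ is the ideal of $S$ generated by the coefficients of $f$; $S$ is Gaussian if $c(fg)=c(f)c(g)$ for all $f,g\in S[X]$, where the product of ideals $IJ$ is the set of finite sums $\sum a_ib_i$ with $a_i\in I$, $b_i\in J$. An element $s\in S$ is multiplicatively cancellable (MC) if $sb=sc$ implies $b=c$ for all $b,c\in S$. The total quotient semiring $Q(S)$ is the localization of $S$ at the set $M$ of its MC elements: the set of classes $a/b$ of pairs $(a,b)\in S\times M$ under $(a,b)\sim(c,d)$ iff $tad=tbc$ for some $t\in M$, with $a/b+c/d=(ad+bc)/(bd)$ and $(a/b)(c/d)=(ac)/(bd)$; $S$ is viewed inside $Q(S)$ via $s\mapsto s/1$. A fractional ideal of $S$ is a nonempty subset $I\subseteq Q(S)$ closed under addition and under multiplication by elements of $S$, such that $dI\subseteq S$ for some MC element $d\in S$. The product of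 fractional ideals is $IJ=\{a_1b_1+\cdots+a_nb_n: a_i\in I,\ b_i\in J\}$. A fractional ideal (in particular an ideal) $I$ of $S$ is invertible if $IJ=S$ for some fractional ideal $J$ of $S$. A semiring $S$ is a Prüfer semiring if every nonzero finitely generated ideal of $S$ is invertible. *)

(* Defs.v *)
From HB Require Import structures.
From mathcomp Require Import all_boot all_order all_algebra.
From mathcomp Require Import generic_quotient ring.
From mathcomp Require Import boolp classical_sets.

Set Implicit Arguments.
Unset Strict Implicit.
Unset Printing Implicit Defensive.

Import GRing.Theory.
Local Open Scope ring_scope.
Local Open Scope classical_set_scope.
Local Open Scope quotient_scope.

(* Commutative semirings with 1 != 0 are MathComp's comNzSemiRingType; its
   instances include the commutative rings and integral domains. *)

Section Ideals.
Variable S : comNzSemiRingType.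
Implicit Types (I J K : set S) (a b x : S).

(* When S is a ring, closure under multiplication by -1 makes these the usual
   ideals of the ring. *)
Definition is_ideal I :=
  [/\ I !=set0, (forall a b, I a -> I b -> I (a + b))
    & (forall s a, I a -> I (s * a))].

Definition ideal_gen (A : set S) : set S := smallest is_ideal A.

Definition fg_ideal I := exists s : seq S, I = ideal_gen [set` s].

Definition set_sum I J : set S := [set a + b | a in I & b in J].

(* All finite sums of products a * b with a in I and b in J; each element p of
   s is one such pair (a, b). *)
Definition set_prod I J : set S :=
  [set x | exists2 s : seq (S * S),
     (forall p, p \in s -> I p.1 /\ J p.2) & x = \sum_(p <- s) p.1 * p.2].

Lemma ideal0 I : is_ideal I -> I 0.
Proof. by move=> [[x Ix] _ /(_ 0 _ Ix)]; rewrite mul0r. Qed.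

Lemma ideal_genP A : is_ideal (ideal_gen A).
Proof.
split; first by exists 0 => I [/ideal0].
- by move=> a b ha hb I [hI AI]; case: (hI) => _ + _; apply; [exact: ha|exact: hb].
- by move=> s a ha I [hI AI]; case: (hI) => _ _; apply; exact: ha.
Qed.

Lemma fg_idealP I : fg_ideal I -> is_ideal I.
Proof. by move=> [s ->]; exact: ideal_genP. Qed.

Lemma set_sum_ideal I J : is_ideal I -> is_ideal J -> is_ideal (set_sum I J).
Proof.
move=> hI hJ; have [_ ID IM] := hI; have [_ JD JM] := hJ.
split; first by exists (0 + 0), 0; [exact: ideal0|exists 0 => //; exact: ideal0].
- move=> _ _ [a Ia [b Jb <-]] [c Ic [d Jd <-]]; rewrite addrACA.
  by exists (a + c); [exact: ID|exists (b + d) => //; exact: JD].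
- move=> s _ [a Ia [b Jb <-]]; rewrite mulrDr.
  by exists (s * a); [exact: IM|exists (s * b) => //; exact: JM].
Qed.

Lemma set_prod_ideal I J : is_ideal I -> is_ideal (set_prod I J).
Proof.
move=> [_ _ IM]; split; first by exists 0, [::]; rewrite ?big_nil.
- move=> _ _ [s hs ->] [t ht ->]; exists (s ++ t); last by rewrite big_cat.
  by move=> p; rewrite mem_cat => /orP[/hs|/ht].
- move=> c _ [s hs ->]; exists [seq (c * p.1, p.2) | p <- s].
    by move=> _ /mapP[p /hs[Ip Jp] ->]; split => //; exact: IM.
  by rewrite big_map mulr_sumr; apply: eq_bigr => p _; rewrite mulrA.
Qed.

Lemma set_prod_mem I J a b : I a -> J b -> set_prod I J (a * b).
Proof.
move=> Ia Jb; exists [:: (a, b)]; last by rewrite big_seq1.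
by move=> p; rewrite inE => /eqP ->.
Qed.

Lemma set_prod_sub I J K : is_ideal K ->
  (forall a b, I a -> J b -> K (a * b)) -> set_prod I J `<=` K.
Proof.
move=> hK h _ [s hs ->]; have [_ KD _] := hK; rewrite big_seq.
by apply: big_ind; [exact: ideal0|exact: KD|move=> p /hs[]; exact: h].
Qed.

Lemma colon_ideal K a : is_ideal K -> is_ideal [set x | K (a * x)].
Proof.
move=> hK; have [_ KD KM] := hK; split; first by exists 0; rewrite /= mulr0; exact: ideal0.
- by move=> x y /= Kx Ky; rewrite mulrDr; exact: KD.
- by move=> s x /= Kx; rewrite mulrCA; exact: KM.
Qed.

Lemma fg_set_sum I J : fg_ideal I -> fg_ideal J -> fg_ideal (set_sum I J).
Proof.
move=> [s ->] [t ->]; exists (s ++ t); apply/seteqP; split.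
- have hK := ideal_genP [set` s ++ t]; have [_ D _] := hK.
  move=> _ [a sa [b tb <-]]; apply: D.
    apply: (smallest_sub hK _ sa) => x /= xs.
    by apply: sub_gen_smallest; rewrite /= mem_cat xs.
  apply: (smallest_sub hK _ tb) => x /= xs.
  by apply: sub_gen_smallest; rewrite /= mem_cat xs orbT.
- apply: smallest_sub; first by apply: set_sum_ideal; exact: ideal_genP.
  move=> x /=; rewrite mem_cat => /orP[xs|xt].
    exists x; first exact: sub_gen_smallest.
    by exists 0; [exact: (ideal0 (ideal_genP _))|rewrite addr0].
  exists 0; first exact: (ideal0 (ideal_genP _)).
  by exists x; [exact: sub_gen_smallest|rewrite add0r].
Qed.

Lemma fg_set_prod I J : fg_ideal I -> fg_ideal J -> fg_ideal (set_prod I J).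
Proof.
move=> [s ->] [t ->]; exists [seq a * b | a <- s, b <- t].
have hK := ideal_genP [set` [seq a * b | a <- s, b <- t]].
apply/seteqP; split.
- apply: set_prod_sub => // a b sa tb.
  apply: (smallest_sub (colon_ideal a hK) _ tb) => y /= yt; rewrite mulrC.
  apply: (smallest_sub (colon_ideal y hK) _ sa) => x /= xs; rewrite mulrC.
  by apply: sub_gen_smallest; exact: allpairs_f.
- apply: smallest_sub; first exact: (set_prod_ideal _ (ideal_genP _)).
  move=> _ /= /allpairsP[[a b] /= [sa tb ->]].
  by apply: set_prod_mem; exact: sub_gen_smallest.
Qed.

Lemma fg_zero : fg_ideal [set 0].
Proof.
exists [::]; apply/seteqP; split; first by move=> _ ->; exact: (ideal0 (ideal_genP _)).
apply: smallest_sub => //; split; first by exists 0.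
- by move=> _ _ -> ->; rewrite addr0.
- by move=> s _ ->; rewrite mulr0.
Qed.

Lemma fg_setT : fg_ideal [set: S].
Proof.
exists [:: 1]; apply/seteqP; split => // x _ I [[_ _ IM] I1].
by rewrite -(mulr1 x); apply: IM; apply: I1; rewrite /= inE.
Qed.

End Ideals.

Section FId.
Variable S : comNzSemiRingType.

Record FId := MkFId { fid_set :> set S; fid_fg : fg_ideal fid_set }.

HB.instance Definition _ := gen_eqMixin FId.
HB.instance Definition _ := gen_choiceMixin FId.

Lemma fid_inj : injective fid_set.
Proof.
by move=> [I hI] [J hJ] /= E; case: J / E hJ => hJ; congr MkFId; exact: Prop_irrelevance.
Qed.

Lemma fid_ideal (I : FId) : is_ideal I.
Proof. exact/fg_idealP/fid_fg. Qed.

Definition fid_zero := MkFId (fg_zero S).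
Definition fid_one := MkFId (fg_setT S).
Definition fid_add (I J : FId) := MkFId (fg_set_sum (fid_fg I) (fid_fg J)).
Definition fid_mul (I J : FId) := MkFId (fg_set_prod (fid_fg I) (fid_fg J)).

Lemma fid_addA : associative fid_add.
Proof.
move=> I J K; apply/fid_inj/seteqP; split => x /=.
- move=> [a Ia [_ [b Jb [c Kc <-]] <-]]; exists (a + b); first by exists a => //; exists b.
  by exists c => //; rewrite addrA.
- move=> [_ [a Ia [b Jb <-]] [c Kc <-]]; exists a => //.
  by exists (b + c); [exists b => //; exists c|rewrite addrA].
Qed.

Lemma fid_addC : commutative fid_add.
Proof.
suff sub (I J : FId) : fid_add I J `<=` fid_add J I by move=> I J; exact/fid_inj/seteqP.
by move=> x [a Ia [b Jb <-]]; exists b => //; exists a => //; rewrite addrC.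
Qed.

Lemma fid_add0 : left_id fid_zero fid_add.
Proof.
move=> I; apply/fid_inj/seteqP; split => x /=.
  by move=> [_ -> [b Ib <-]]; rewrite add0r.
by move=> Ix; exists 0 => //; exists x => //; rewrite add0r.
Qed.

HB.instance Definition _ := GRing.isNmodule.Build FId fid_addA fid_addC fid_add0.

Lemma fid_mulC : commutative fid_mul.
Proof.
suff sub (I J : FId) : fid_mul I J `<=` fid_mul J I by move=> I J; exact/fid_inj/seteqP.
apply: set_prod_sub; first exact: fid_ideal.
by move=> a b Ia Jb; rewrite mulrC; exact: set_prod_mem.
Qed.

Lemma fid_mulA : associative fid_mul.
Proof.
have sub (I J K : FId) : fid_mul I (fid_mul J K) `<=` fid_mul (fid_mul I J) K.
  have hL := fid_ideal (fid_mul (fid_mul I J) K).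
  apply: set_prod_sub => // a y Ia.
  apply: (set_prod_sub (colon_ideal a hL)) => b c Jb Kc /=.
  by rewrite mulrA; do 2?apply: set_prod_mem.
move=> I J K; apply/fid_inj/seteqP; split; first exact: sub.
by rewrite fid_mulC (fid_mulC I J) (fid_mulC I) (fid_mulC J K); exact: sub.
Qed.

Lemma fid_mul1 : left_id fid_one fid_mul.
Proof.
move=> I; apply/fid_inj/seteqP; split => [|x Ix].
  apply: set_prod_sub; first exact: fid_ideal.
  by move=> a b _; case: (fid_ideal I) => _ _; apply.
by rewrite -(mul1r x); exact: set_prod_mem.
Qed.

Lemma fid_mulD : left_distributive fid_mul fid_add.
Proof.
move=> I J K; apply/fid_inj/seteqP; split.
  apply: set_prod_sub; first exact: fid_ideal.
  move=> _ c [a Ia [b Jb <-]] Kc; exists (a * c); first exact: set_prod_mem.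
  by exists (b * c); [exact: set_prod_mem|rewrite mulrDl].
move=> _ [x xIK [y yJK <-]].
have [_ D _] := fid_ideal (fid_mul (fid_add I J) K); apply: D.
- apply: set_prod_sub xIK; first exact: fid_ideal.
  move=> a c Ia Kc; apply: set_prod_mem => //; exists a => //.
  by exists 0; [exact: (ideal0 (fid_ideal _))|rewrite addr0].
- apply: set_prod_sub yJK; first exact: fid_ideal.
  move=> b c Jb Kc; apply: set_prod_mem => //.
  by exists 0; [exact: (ideal0 (fid_ideal _))|exists b => //; rewrite add0r].
Qed.

Lemma fid_mul0 : left_zero fid_zero fid_mul.
Proof.
move=> I; apply/fid_inj/seteqP; split.
  apply: set_prod_sub; first exact: fid_ideal.
  by move=> _ b -> _; rewrite mul0r.
by move=> _ ->; exact: (ideal0 (fid_ideal _)).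
Qed.

Lemma fid_one_neq0 : fid_one != fid_zero.
Proof.
apply/eqP => /(congr1 fid_set) /= E.
have : [set 0] (1 : S) by rewrite -E.
by move=> /= /eqP; rewrite oner_eq0.
Qed.

HB.instance Definition _ := GRing.Nmodule_isComNzSemiRing.Build FId
  fid_mulA fid_mulC fid_mul1 fid_mulD fid_mul0 fid_one_neq0.

End FId.

(* GRing.lreg b says that b is multiplicatively cancellable. *)
Section TotalQuotient.
Variable S : comNzSemiRingType.

Definition mc_elt := {b : S | `[< GRing.lreg b >]}.

Lemma mc_eltP (b : mc_elt) : GRing.lreg (val b).
Proof. exact/asboolP/(valP b). Qed.

Definition mk_mc b (hb : GRing.lreg b) : mc_elt := Sub b (asboolT hb).

Definition mc_one : mc_elt := mk_mc (@lreg1 S).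

Definition mc_mul (b d : mc_elt) : mc_elt :=
  mk_mc (lregM (@mc_eltP b) (@mc_eltP d)).

Definition prefrac := (S * mc_elt)%type.
Implicit Types x y z : prefrac.

Definition frac_rel x y : bool :=
  `[< exists2 t : S, GRing.lreg t & t * x.1 * val y.2 = t * val x.2 * y.1 >].

(* A cancellable t can be removed from the defining equation. *)
Lemma frac_relP x y : reflect (x.1 * val y.2 = val x.2 * y.1) (frac_rel x y).
Proof.
rewrite /frac_rel; apply: (iffP (asboolP _)) => [[t ht]|E]; first by rewrite -!mulrA => /ht.
by exists 1; [exact: lreg1|rewrite !mul1r].
Qed.

Lemma frac_rel_refl : reflexive frac_rel.
Proof. by move=> x; apply/frac_relP; rewrite mulrC. Qed.

Lemma frac_rel_sym : symmetric frac_rel.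
Proof.
by move=> x y; apply/frac_relP/frac_relP => E; rewrite mulrC -E mulrC.
Qed.

Lemma frac_rel_trans : transitive frac_rel.
Proof.
move=> y x z /frac_relP xy /frac_relP yz; apply/frac_relP.
apply: (@mc_eltP y.2); rewrite mulrA [val y.2 * _]mulrC xy.
by rewrite -!mulrA yz mulrCA.
Qed.

Definition frac_equiv :=
  EquivRel frac_rel frac_rel_refl frac_rel_sym frac_rel_trans.

Definition Qtot := {eq_quot frac_equiv}.

HB.instance Definition _ : EqQuotient _ frac_equiv Qtot := EqQuotient.on Qtot.
HB.instance Definition _ := Choice.on Qtot.

Definition pre_add x y : prefrac :=
  (x.1 * val y.2 + val x.2 * y.1, mc_mul x.2 y.2).
Definition pre_mul x y : prefrac := (x.1 * y.1, mc_mul x.2 y.2).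

Definition q_add := lift_op2 Qtot pre_add.
Definition q_mul := lift_op2 Qtot pre_mul.

Lemma frac_rel_repr x : (repr (\pi_Qtot x)).1 * val x.2 = val (repr (\pi_Qtot x)).2 * x.1.
Proof.
apply/frac_relP; have /eqmodP : \pi_Qtot (repr (\pi_Qtot x)) = \pi_Qtot x by rewrite reprK.
exact.
Qed.

Lemma pi_q_add : {morph \pi : x y / pre_add x y >-> q_add x y}.
Proof.
move=> x y; unlock q_add; apply/eqmodP => /=; rewrite frac_rel_sym.
apply/frac_relP => /=; rewrite mulrDl mulrDr.
have Eu := frac_rel_repr x; have Ev := frac_rel_repr y.
move: Eu Ev; move: (repr _) (repr _) => v u /= Eu Ev; congr (_ + _).
  by rewrite mulrACA Eu; ring.
by rewrite mulrACA Ev; ring.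
Qed.
Canonical pi_q_add_morph := PiMorph2 pi_q_add.

Lemma pi_q_mul : {morph \pi : x y / pre_mul x y >-> q_mul x y}.
Proof.
move=> x y; unlock q_mul; apply/eqmodP => /=; rewrite frac_rel_sym.
by apply/frac_relP => /=; rewrite mulrACA !frac_rel_repr mulrACA.
Qed.
Canonical pi_q_mul_morph := PiMorph2 pi_q_mul.

Definition mkfrac (a : S) (b : mc_elt) : Qtot := \pi_Qtot (a, b).

(* The canonical map s |-> s / 1. *)
Definition toQ (s : S) : Qtot := mkfrac s mc_one.

Lemma mkfrac_eq x y : x.1 * val y.2 = val x.2 * y.1 -> \pi_Qtot x = \pi_Qtot y.
Proof. by move=> E; apply/eqmodP/frac_relP. Qed.

Lemma q_addA : associative q_add.
Proof.
elim/quotW=> x; elim/quotW=> y; elim/quotW=> z; rewrite -!pi_q_add.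
congr (\pi); rewrite /pre_add /=; congr pair; last by apply: val_inj; rewrite /= mulrA.
by rewrite mulrDl mulrDr !mulrA addrA.
Qed.

Lemma q_addC : commutative q_add.
Proof.
elim/quotW=> x; elim/quotW=> y; rewrite -!pi_q_add.
congr (\pi); rewrite /pre_add /=; congr pair; last by apply: val_inj; rewrite /= mulrC.
by rewrite addrC mulrC [x.1 * _]mulrC.
Qed.

Lemma q_add0 : left_id (toQ 0) q_add.
Proof.
elim/quotW=> x; rewrite /toQ /mkfrac -pi_q_add; apply: mkfrac_eq => /=.
by rewrite mul0r add0r !mul1r mulrC.
Qed.

HB.instance Definition _ := GRing.isNmodule.Build Qtot q_addA q_addC q_add0.

Lemma q_mulA : associative q_mul.
Proof.
elim/quotW=> x; elim/quotW=> y; elim/quotW=> z; rewrite -!pi_q_mul.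
congr (\pi); rewrite /pre_mul /= mulrA; congr pair.
by apply: val_inj; rewrite /= mulrA.
Qed.

Lemma q_mulC : commutative q_mul.
Proof.
elim/quotW=> x; elim/quotW=> y; rewrite -!pi_q_mul.
congr (\pi); rewrite /pre_mul /= mulrC; congr pair.
by apply: val_inj; rewrite /= mulrC.
Qed.

Lemma q_mul1 : left_id (toQ 1) q_mul.
Proof.
elim/quotW=> x; rewrite /toQ /mkfrac -pi_q_mul; apply: mkfrac_eq => /=.
by rewrite !mul1r mulrC.
Qed.

Lemma q_mulD : left_distributive q_mul q_add.
Proof.
elim/quotW=> x; elim/quotW=> y; elim/quotW=> z.
rewrite -pi_q_add -!pi_q_mul -pi_q_add; apply: mkfrac_eq => /=.
by ring.
Qed.

Lemma q_mul0 : left_zero (toQ 0) q_mul.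
Proof.
elim/quotW=> x; rewrite /toQ /mkfrac -pi_q_mul; apply: mkfrac_eq => /=.
by rewrite !mul0r mulr0.
Qed.

Lemma q_one_neq0 : toQ 1 != toQ 0.
Proof.
apply/eqP => /eqmodP /= /frac_relP /= /eqP.
by rewrite !mul1r oner_eq0.
Qed.

HB.instance Definition _ := GRing.Nmodule_isComNzSemiRing.Build Qtot
  q_mulA q_mulC q_mul1 q_mulD q_mul0 q_one_neq0.

Lemma mkfracD a b c d :
  mkfrac a b + mkfrac c d = mkfrac (a * val d + val b * c) (mc_mul b d).
Proof. exact: esym (pi_q_add (a, b) (c, d)). Qed.

Lemma mkfracM a b c d : mkfrac a b * mkfrac c d = mkfrac (a * c) (mc_mul b d).
Proof. exact: esym (pi_q_mul (a, b) (c, d)). Qed.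

End TotalQuotient.

Section Properties.
Variable S : comNzSemiRingType.

Definition is_fractional (I : set (Qtot S)) :=
  [/\ I !=set0, (forall a b, I a -> I b -> I (a + b)),
      (forall (s : S) a, I a -> I (toQ s * a))
    & (exists2 d : S, GRing.lreg d & [set toQ d * a | a in I] `<=` range (@toQ S))].

Definition invertible (I : set (Qtot S)) :=
  exists2 J, is_fractional J & set_prod I J = range (@toQ S).

Definition prufer_semiring := forall I : set S,
  fg_ideal I -> I <> [set 0] -> invertible (@toQ S @` I).

Definition content (f : {poly S}) : set S := ideal_gen (range (fun i : nat => f`_i)).

Definition gaussian := forall f g : {poly S},
  content (f * g) = set_prod (content f) (content g).

End Properties.

(* In a domain D the cancellable elements are the nonzero ones, so Qtot D is the
   field of fractions of D. *)
Definition prufer_domain (D : idomainType) := prufer_semiring D.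

(* Main.v *)
Require Import Defs.
From mathcomp Require Import all_boot all_order all_algebra.
From mathcomp Require Import ring boolp classical_sets.

(** For finitely generated ideals of a Prüfer domain, to contain is to divide:
    if I is contained in J, then I = J * (J^-1 * I) (lemma [prufer_dvd]). Since
    the sum I + J contains I, the semiring of finitely generated ideals has the
    property that every sum divides each of its summands. This property alone,
    in any semiring S, makes each finitely generated ideal of S principal,
    generated by the sum of the given generators.

    The content of a polynomial f is thus the principal ideal generated by the
    sum of the coefficients, which is the value f.[1]. As evaluation at 1 is
    multiplicative, the content is multiplicative too ([sum_dvd_gaussian]).

    The second ingredient is that nonzero elements J of FId D are cancellable:
    J divides the principal ideal generated by any nonzero d in J, and that
    ideal is cancellable because D is a domain ([prufer_cancel]). A principal
    ideal with cancellable generator a has the inverse generated by 1 / a, so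
    the semiring is Prüfer ([sum_dvd_prufer]). *)

Set Implicit Arguments.
Unset Strict Implicit.
Unset Printing Implicit Defensive.

Import GRing.Theory.
Local Open Scope ring_scope.
Local Open Scope classical_set_scope.

Section Principal.
Variable S : comNzSemiRingType.
Implicit Types (a b x : S) (A : set S).

Definition principal a : set S := range ( *%R a).

Lemma principal_ideal a : is_ideal (principal a).
Proof.
split; first by exists (a * 0), 0.
- by move=> _ _ [x _ <-] [y _ <-]; exists (x + y) => //; rewrite mulrDr.
- by move=> s _ [x _ <-]; exists (s * x) => //; rewrite mulrCA.
Qed.

Lemma ideal_gen_principal A a :
  ideal_gen A a -> A `<=` principal a -> ideal_gen A = principal a.
Proof.
move=> Aa Asub; apply/seteqP; split.
  by apply: smallest_sub => //; exact: principal_ideal.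
have [_ _ AM] := ideal_genP A.
by move=> _ [c _ <-]; rewrite mulrC; exact: AM.
Qed.

Lemma set_prod_principal a b :
  set_prod (principal a) (principal b) = principal (a * b).
Proof.
apply/seteqP; split.
  apply: set_prod_sub; first exact: principal_ideal.
  by move=> _ _ [x _ <-] [y _ <-]; exists (x * y) => //; rewrite mulrACA.
move=> _ [c _ <-]; rewrite -mulrA; apply: set_prod_mem.
  by exists 1 => //; rewrite mulr1.
by exists c.
Qed.

End Principal.

Section ToQ.
Variable S : comNzSemiRingType.

Lemma toQ_inj : injective (@toQ S).
Proof.
by move=> a b /eqmodP /= /frac_relP /=; rewrite mulr1 mul1r.
Qed.

Lemma toQD (a b : S) : toQ (a + b) = toQ a + toQ b.
Proof. by rewrite mkfracD; apply: mkfrac_eq => /=; rewrite !mulr1 !mul1r. Qed.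

Lemma toQM (a b : S) : toQ (a * b) = toQ a * toQ b.
Proof. by rewrite mkfracM; apply: mkfrac_eq => /=; rewrite !mulr1 !mul1r. Qed.

End ToQ.

Section SumDivides.
Variable S : comNzSemiRingType.

Definition sum_dvd_summands := forall a b : S, exists c, a = (a + b) * c.

Hypothesis sum_dvd : sum_dvd_summands.

Lemma dvd_big_sum (s : seq S) x : x \in s -> principal (\sum_(y <- s) y) x.
Proof.
move=> xs; rewrite (big_rem x) //=.
by have [c Ec] := sum_dvd x (\sum_(y <- rem x s) y); exists c.
Qed.

Lemma ideal_gen_sum (s : seq S) :
  ideal_gen [set` s] = principal (\sum_(y <- s) y).
Proof.
apply: ideal_gen_principal => [|x /= /dvd_big_sum//].
have hI := ideal_genP [set` s]; have [_ D _] := hI.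
rewrite big_seq; apply: big_ind => [||x xs]; [exact: ideal0|exact: D|].
exact: sub_gen_smallest.
Qed.

(** The content is written with f.[1], rather than with a sum of coefficients,
    because evaluation at 1 commutes with products. *)
Lemma content_principal (f : {poly S}) : content f = principal f.[1].
Proof.
have -> : f.[1] = \sum_(y <- (f : seq S)) y.
  rewrite horner_coef (big_nth 0) big_mkord.
  by apply: eq_bigr => i _; rewrite expr1n mulr1.
rewrite -ideal_gen_sum; have hI := ideal_genP [set` (f : seq S)].
apply/seteqP; split; apply: smallest_sub; try exact: ideal_genP.
  move=> _ [i _ <-]; have [i_lt|i_ge] := ltnP i (size f).
    by apply: sub_gen_smallest; exact: mem_nth.
  by rewrite nth_default //; exact: ideal0.
move=> x /= /(nthP 0) [i _ <-]; apply: sub_gen_smallest.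
by exists i.
Qed.

Lemma sum_dvd_gaussian : gaussian S.
Proof.
by move=> f g; rewrite !content_principal set_prod_principal hornerM.
Qed.

(** The inverse of the ideal generated by a is the set of all c / a. *)
Lemma principal_invertible (a : S) :
  GRing.lreg a -> invertible (@toQ S @` principal a).
Proof.
move=> a_reg; pose m := mk_mc a_reg.
have toQ_mkfrac x c : toQ (a * x) * mkfrac c m = toQ (x * c).
  rewrite mkfracM; apply: mkfrac_eq => /=.
  by rewrite mulr1 mul1r mulrA.
exists (range (fun c => mkfrac c m)).
  split; first by exists (mkfrac 0 m), 0.
  - move=> _ _ [x _ <-] [y _ <-]; exists (x + y) => //.
    rewrite mkfracD; apply: mkfrac_eq => /=.
    by ring.
  - move=> s _ [x _ <-]; exists (s * x) => //.
    rewrite mkfracM; apply: mkfrac_eq => /=.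
    by rewrite mul1r mulrC.
  - exists a => // _ [_ [x _ <-] <-]; exists x => //.
    by rewrite -[a in RHS]mulr1 toQ_mkfrac mul1r.
apply/seteqP; split.
- move=> _ [s hs ->]; rewrite big_seq; apply: big_ind.
  + by exists 0.
  + by move=> _ _ [x _ <-] [y _ <-]; exists (x + y) => //; rewrite toQD.
  + move=> [_ _] /hs /= [[_ [x _ <-] <-] [c _ <-]].
    by exists (x * c) => //; rewrite toQ_mkfrac.
- move=> _ [c _ <-]; rewrite -[c]mul1r -toQ_mkfrac.
  by apply: set_prod_mem; [exists (a * 1) => //; exists 1|exists c].
Qed.

Lemma sum_dvd_prufer : (forall a : S, a != 0 -> GRing.lreg a) -> prufer_semiring S.
Proof.
move=> cancel _ [s ->]; rewrite ideal_gen_sum.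
move: (\sum_(y <- s) y) => a a_neq0; apply/principal_invertible/cancel.
apply/eqP => a0; apply: a_neq0; rewrite a0; apply/seteqP; split.
  by move=> _ [c _ <-]; rewrite /= mul0r.
by move=> _ ->; exists 0 => //; rewrite mulr0.
Qed.

End SumDivides.

Section PruferDomain.
Variable D : idomainType.
Hypothesis prD : prufer_domain D.
Implicit Types (I J K L : FId D) (d : D).

Lemma fid_eq0P J : reflect (fid_set J = [set 0]) (J == 0).
Proof. by apply: (iffP eqP) => [->|E] //; apply: fid_inj. Qed.

(** For J nonzero, write 1 as a sum of products a_i * b_i with a_i in J and b_i
    in J^-1. The quotient is then generated by the products b_i * x, for x among
    finitely many generators of I; these lie in D because x is in J. *)
Lemma prufer_dvd I J : fid_set I `<=` fid_set J -> exists K, I = J * K.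
Proof.
move=> IJ; have [J0|/fid_eq0P J_neq0] := boolP (J == 0).
  exists 1; rewrite mulr1; apply: fid_inj; apply/seteqP; split=> // x.
  by rewrite (fid_eq0P _ J0) => ->; exact: (ideal0 (fid_ideal _)).
have [X _ EX] := prD (fid_fg J) J_neq0.
have mulJX a b : fid_set J a -> X b -> exists z, toQ z = toQ a * b.
  move=> Ja Xb; have : set_prod (@toQ D @` J) X (toQ a * b).
    by apply: set_prod_mem => //; exists a.
  by rewrite EX => -[z _ Ez]; exists z.
have : set_prod (@toQ D @` J) X (toQ 1) by rewrite EX; exists 1.
move=> [s hs E1]; have [r Er] := fid_fg I.
have rI x : x \in r -> fid_set I x.
  by move=> xr; rewrite Er; exact: sub_gen_smallest.
(* y x b is the element b * x of D, when there is one. *)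
pose y (x : D) (b : Qtot D) : D := xget 0 [set z : D | toQ z = toQ x * b].
have yE x b : fid_set J x -> X b -> toQ (y x b) = toQ x * b.
  by move=> Jx /(mulJX _ _ Jx) /cid [z Ez]; rewrite /y; case: xgetP => // /(_ z).
have fgK : fg_ideal (ideal_gen [set` [seq y x p.2 | x <- r, p <- s]]).
  by exists [seq y x p.2 | x <- r, p <- s].
pose K := MkFId fgK.
exists K; apply: fid_inj; apply/seteqP; split; last first.
  have hI := fid_ideal I; have [_ _ IM] := hI.
  apply: set_prod_sub => // a w Ja; apply: (smallest_sub (colon_ideal a hI)).
  move=> _ /= /allpairsP [[x p] /= [xr ps ->]].
  have [_ Xp] := hs _ ps; have Ix := rI _ xr.
  have [z Ez] := mulJX _ _ Ja Xp.
  suff -> : a * y x p.2 = z * x by exact: IM.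
  apply: toQ_inj; rewrite !toQM Ez yE //; last exact: IJ.
  by rewrite mulrA mulrAC.
rewrite {1}Er; have hJK := fid_ideal (J * K); apply: smallest_sub => // x /= xr.
suff [z JKz /toQ_inj <-//] : (@toQ D @` fid_set (J * K)) (toQ x).
have -> : toQ x = \sum_(p <- s) p.1 * (toQ x * p.2).
  rewrite -[x in LHS]mul1r toQM E1 mulr_suml; apply: eq_bigr => p _.
  by rewrite mulrAC mulrA.
rewrite big_seq; apply: big_ind.
- by exists 0 => //; exact: (ideal0 hJK).
- move=> _ _ [a aJK <-] [b bJK <-]; exists (a + b); last exact: toQD.
  by case: hJK => _ + _; apply.
- move=> [q b] ps; have [/= [a Ja <-] Xb] := hs _ ps.
  have Jx := IJ _ (rI _ xr).
  exists (a * y x b); last by rewrite toQM yE.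
  apply: set_prod_mem => //; apply: sub_gen_smallest.
  exact: (allpairs_f (fun x p => y x p.2) xr ps).
Qed.

Lemma fid_sum_dvd : sum_dvd_summands (FId D).
Proof.
move=> I J; apply: prufer_dvd => x Ix.
by exists x => //; exists 0; [exact: (ideal0 (fid_ideal _))|rewrite addr0].
Qed.

Lemma fg_principal d : fg_ideal (principal d).
Proof.
exists [:: d]; apply/esym/ideal_gen_principal.
  by apply: sub_gen_smallest; rewrite /= inE.
by move=> x /=; rewrite inE => /eqP ->; exists 1 => //; rewrite mulr1.
Qed.

Definition fid_principal d := MkFId (fg_principal d).

Lemma fid_principal_mul d K x :
  fid_set (fid_principal d * K) x <-> exists2 y, fid_set K y & x = d * y.
Proof.
split=> [[s hs ->]|[y Ky ->]]; last first.
  by apply: set_prod_mem => //; exists 1 => //; rewrite mulr1.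
have hK := fid_ideal K; have [_ KD KM] := hK.
rewrite big_seq; elim/big_ind: _ => [|_ _ [a Ka ->] [b Kb ->]|p /hs].
- by exists 0; [exact: ideal0|rewrite mulr0].
- by exists (a + b); [exact: KD|rewrite mulrDr].
- move=> [[c _ <-] Kp]; exists (c * p.2); [exact: KM|].
  by rewrite mulrA.
Qed.

Lemma fid_principal_cancel d : d != 0 -> GRing.lreg (fid_principal d).
Proof.
move=> d_neq0; suff sub K L : fid_principal d * K = fid_principal d * L ->
    fid_set K `<=` fid_set L.
  by move=> K L E; apply: fid_inj; apply/seteqP; split; exact: sub.
move=> E x Kx; have : fid_set (fid_principal d * K) (d * x).
  by apply/fid_principal_mul; exists x.
by rewrite E => /fid_principal_mul [y Ly /(mulfI d_neq0) ->].
Qed.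

Lemma prufer_cancel J : J != 0 -> GRing.lreg J.
Proof.
move=> J_neq0; have [d Jd d_neq0] : exists2 d, fid_set J d & d != 0.
  apply: contrapT => noJ; move/fid_eq0P: J_neq0; apply; apply/seteqP; split.
    by move=> x Jx; apply/eqP; apply: contra_notT noJ => x0; exists x.
  by move=> _ ->; exact: (ideal0 (fid_ideal _)).
have [K EK] : exists K, fid_principal d = J * K.
  apply: prufer_dvd => _ [c _ <-]; rewrite mulrC.
  by case: (fid_ideal J) => _ _; apply.
have := fid_principal_cancel d_neq0; rewrite EK mulrC => KJ_reg L M E.
by apply: KJ_reg; rewrite /= -!mulrA E.
Qed.

End PruferDomain.

Theorem corollary4p8 (D : idomainType) :
  prufer_domain D -> gaussian (FId D) /\ prufer_semiring (FId D).
Proof.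
move=> prD; have dvd := fid_sum_dvd prD.
split; first exact: sum_dvd_gaussian.
by apply: sum_dvd_prufer => // J; exact: prufer_cancel.
Qed.
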